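(* Let $T$ be a hemi-Nelson algebra. For every congruence $\theta$ of $T$, the class $1/\theta$ is an h-implicative filter of $T$; for every h-implicative filter $F$ of $T$, the relation $\Theta(F)=\{(x,y)\in T\times T: s(x,y)\in F\}$ is a congruence of $T$. The assignments $\theta\mapsto 1/\theta$ and $F\mapsto\Theta(F)$ are mutually inverse order isomorphisms between the set $\mathrm{Con}(T)$ of congruences of $T$ and the set $\mathrm{hIF}(T)$ of h-implicative filters of $T$, both ordered by inclusion.
   Context: A Kleene algebra is a bounded distributive lattice $\langle T,\wedge,\vee,0,1\rangle$ with a unary operation $\sim$ such that $\sim\sim x=x$, $\sim(x\wedge y)=\sim x\vee\sim y$ and $(x\wedge\sim x)\wedge(y\vee\sim y)=x\wedge\sim x$. A hemi-Nelson algebra is an algebra $\langle T,\wedge,\vee,\rightarrow,\sim,0,1\rangle$ of type $(2,2,2,1,0,0)$ such that $\langle T,\wedge,\vee,\sim,0,1\rangle$ is a Kleene algebra and for all $x,y,z\in T$: (hN1) $x\rightarrow x=1$; (hN2) $x\wedge(x\rightarrow y)\le x\wedge(\sim x\vee y)$; (hN3) $\sim(x\rightarrow y)\rightarrow(x\wedge\sim y)=1$; (hN4) $(x\wedge\sim y)\rightarrow\sim(x\rightarrow y)=1$; (hN5) $(x\wedge y\wedge(x\rightarrow y))\rightarrow(x\wedge(x\rightarrow y))=1$; (hN6) $(x\wedge(x\rightarrow y))\rightarrow(x\wedge y\wedge(x\rightarrow y))=1$; (hN7) if $x\rightarrow y=1$, $y\rightarrow x=1$, $y\rightarrow z=1$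 and $z\rightarrow y=1$ then $x\rightarrow z=1$ and $z\rightarrow x=1$; (hN8) if $x\rightarrow y=1$ and $y\rightarrow x=1$ then $(x\wedge z)\rightarrow(y\wedge z)=1$; (hN9) if $x\rightarrow y=1$ and $y\rightarrow x=1$ then $(x\vee z)\rightarrow(y\vee z)=1$; (hN10) if $x\rightarrow y=1$ and $y\rightarrow x=1$ then $(x\rightarrow z)\rightarrow(y\rightarrow z)=1$ and $(z\rightarrow x)\rightarrow(z\rightarrow y)=1$. A subset $F\subseteq T$ is an implicative filter if $1\in F$ and for all $x,y\in T$, if $x\in F$ and $x\rightarrow y\in F$ then $y\in F$. It is an h-implicative filter if it is an implicative filter and for all $x,y\in T$ and $f\in F$: (F1) $(x\rightarrow y)\rightarrow((x\wedge f)\rightarrow(y\wedge f))\in F$; (F2) $((x\wedge f)\rightarrow(y\wedge f))\rightarrow(x\rightarrow y)\in F$; (F3) $\sim(x\rightarrow y)\rightarrow\sim((x\wedge f)\rightarrow(y\wedge f))\in F$; (F4) $\sim((x\wedge f)\rightarrow(y\wedge f))\rightarrow\sim(x\rightarrow y)\in F$. Define $x\leftrightarrow y=(x\rightarrow y)\wedge(y\rightarrow x)$ and $s(x,y)=(x\leftrightarrow y)\wedge(\sim x\leftrightarrow\sim y)$. For a congruence $\theta$, $1/\theta$ denotes the $\theta$-class of $1$. *)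

(* Defs.v *)
From HB Require Import structures.
From mathcomp Require Import all_boot all_order.
From mathcomp Require Import boolp classical_sets.

Set Implicit Arguments.
Unset Strict Implicit.
Unset Printing Implicit Defensive.

Import Order.Theory.
Local Open Scope order_scope.

(* The order, meet, join, bounds and distributivity come from the library's
   bounded distributive lattices, where [\bot = \top] is not excluded. *)
HB.mixin Record isKleeneAlgebra (d : Order.disp_t) T
    of Order.TBDistrLattice d T := {
  kneg : T -> T;
  knegK : forall x : T, kneg (kneg x) = x;
  knegI : forall x y : T, kneg (x `&` y) = kneg x `|` kneg y;
  kleene : forall x y : T,
    (x `&` kneg x) `&` (y `|` kneg y) = x `&` kneg x
}.

#[short(type="kleeneAlgType")]
HB.structure Definition KleeneAlgebra (d : Order.disp_t) :=
  { T of Order.TBDistrLattice d T & isKleeneAlgebra d T }.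

HB.mixin Record isHemiNelson (d : Order.disp_t) T of KleeneAlgebra d T := {
  himp : T -> T -> T;
  hN1 : forall x : T, himp x x = \top;
  hN2 : forall x y : T, x `&` himp x y <= x `&` (kneg x `|` y);
  hN3 : forall x y : T, himp (kneg (himp x y)) (x `&` kneg y) = \top;
  hN4 : forall x y : T, himp (x `&` kneg y) (kneg (himp x y)) = \top;
  hN5 : forall x y : T,
    himp (x `&` y `&` himp x y) (x `&` himp x y) = \top;
  hN6 : forall x y : T,
    himp (x `&` himp x y) (x `&` y `&` himp x y) = \top;
  hN7 : forall x y z : T,
    himp x y = \top -> himp y x = \top ->
    himp y z = \top -> himp z y = \top ->
    himp x z = \top /\ himp z x = \top;
  hN8 : forall x y z : T,
    himp x y = \top -> himp y x = \top -> himp (x `&` z) (y `&` z) = \top;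
  hN9 : forall x y z : T,
    himp x y = \top -> himp y x = \top -> himp (x `|` z) (y `|` z) = \top;
  hN10 : forall x y z : T,
    himp x y = \top -> himp y x = \top ->
    himp (himp x z) (himp y z) = \top /\ himp (himp z x) (himp z y) = \top
}.

#[short(type="hemiNelsonType")]
HB.structure Definition HemiNelson (d : Order.disp_t) :=
  { T of KleeneAlgebra d T & isHemiNelson d T }.

Section HemiNelsonDefs.
Context {d : Order.disp_t} {T : hemiNelsonType d}.
Implicit Types (x y : T) (F : set T) (theta : set (T * T)).

Definition hiff x y : T := himp x y `&` himp y x.

Definition hs x y : T := hiff x y `&` hiff (kneg x) (kneg y).

Definition implicative_filter F : Prop :=
  F \top /\ (forall x y, F x -> F (himp x y) -> F y).

Record h_implicative_filter F : Prop := HImplicativeFilter {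
  hif_implicative : implicative_filter F;
  hif_F1 : forall x y f, F f ->
    F (himp (himp x y) (himp (x `&` f) (y `&` f)));
  hif_F2 : forall x y f, F f ->
    F (himp (himp (x `&` f) (y `&` f)) (himp x y));
  hif_F3 : forall x y f, F f ->
    F (himp (kneg (himp x y)) (kneg (himp (x `&` f) (y `&` f))));
  hif_F4 : forall x y f, F f ->
    F (himp (kneg (himp (x `&` f) (y `&` f))) (kneg (himp x y)))
}.

(* Compatibility with the constants [\bot] and [\top] is reflexivity. *)
Record congruence theta : Prop := Congruence {
  cong_equiv : RelationClasses.Equivalence (fun x y => theta (x, y));
  cong_meet : forall x x' y y', theta (x, x') -> theta (y, y') ->
    theta (x `&` y, x' `&` y');
  cong_join : forall x x' y y', theta (x, x') -> theta (y, y') ->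
    theta (x `|` y, x' `|` y');
  cong_imp : forall x x' y y', theta (x, x') -> theta (y, y') ->
    theta (himp x y, himp x' y');
  cong_neg : forall x x', theta (x, x') -> theta (kneg x, kneg x')
}.

Definition class1 theta : set T := [set x | theta (x, \top)]%classic.

Definition Theta F : set (T * T) := [set xy | F (hs xy.1 xy.2)]%classic.

End HemiNelsonDefs.

(* Main.v *)
Require Import Defs.
From HB Require Import structures.
From mathcomp Require Import all_boot all_order.
From mathcomp Require Import boolp classical_sets.

(** Mutual implication [x -> y = y -> x = 1] is an equivalence compatible with
    all operations except negation, and it identifies [~(x -> y)] with
    [x /\ ~y].  An
    h-implicative filter [F] is a lattice filter, and both [x -> y] and
    [y -> x] lie in [F] exactly when [x /\ f] and [y /\ f] are equivalent for
    some [f] in [F]; this description makes compatibility with the operations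
    immediate.  Conversely a congruence is recovered from the class of [1]
    because, by (hN2) and the Kleene inequality, [x -> y = 1] and
    [~y -> ~x = 1] force [x <= y], by lattice identities that can be read
    modulo the congruence. *)

Import Order.Theory.
Local Open Scope order_scope.

(** * Mutual implication and its calculus *)

Section HemiNelsonEquivalence.
Set Implicit Arguments.
Unset Strict Implicit.
Context {d : Order.disp_t} {T : hemiNelsonType d}.
Implicit Types x y z : T.

Definition heq x y : Prop := himp x y = \top /\ himp y x = \top.

Lemma heq_refl x : heq x x.
Proof. by split; exact: hN1. Qed.

Lemma heq_sym x y : heq x y -> heq y x.
Proof. by case. Qed.

Lemma heq_trans y x z : heq x y -> heq y z -> heq x z.
Proof. by move=> [xy yx] [yz zy]; exact: hN7 xy yx yz zy. Qed.

Lemma heqI2r z x y : heq x y -> heq (x `&` z) (y `&` z).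
Proof. by move=> [xy yx]; split; exact: hN8. Qed.

Lemma heqI x x' y y' : heq x x' -> heq y y' -> heq (x `&` y) (x' `&` y').
Proof.
move=> xx' yy'; apply: heq_trans (heqI2r y xx') _.
by rewrite ![x' `&` _]meetC; exact: heqI2r.
Qed.

Lemma heqU2r z x y : heq x y -> heq (x `|` z) (y `|` z).
Proof. by move=> [xy yx]; split; exact: hN9. Qed.

Lemma heqU x x' y y' : heq x x' -> heq y y' -> heq (x `|` y) (x' `|` y').
Proof.
move=> xx' yy'; apply: heq_trans (heqU2r y xx') _.
by rewrite ![x' `|` _]joinC; exact: heqU2r.
Qed.

Lemma heq_imp x x' y y' : heq x x' -> heq y y' -> heq (himp x y) (himp x' y').
Proof.
move=> [xx' x'x] [yy' y'y]; apply: (@heq_trans (himp x' y)).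
  by split; [case: (hN10 _ _ y xx' x'x) | case: (hN10 _ _ y x'x xx')].
by split; [case: (hN10 _ _ x' yy' y'y) | case: (hN10 _ _ x' y'y yy')].
Qed.

Lemma heq_meet_imp x y : heq (x `&` himp x y) (x `&` y `&` himp x y).
Proof. by split; [exact: hN6 | exact: hN5]. Qed.

Lemma heq_neg_imp x y : heq (kneg (himp x y)) (x `&` kneg y).
Proof. by split; [exact: hN3 | exact: hN4]. Qed.

Lemma knegU x y : kneg (x `|` y) = kneg x `&` kneg y.
Proof. by rewrite -[RHS]knegK knegI !knegK. Qed.

Lemma kneg1 : kneg (\top : T) = \bot.
Proof. by have := knegI (kneg \bot) (\top : T); rewrite meetx1 knegK join0x. Qed.

(** The case [y = x] of [heq_neg_imp]: there [x -> x = 1], and [~1 = 0]. *)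
Lemma heq_contradiction x : heq (x `&` kneg x) \bot.
Proof. by apply: heq_sym; have := heq_neg_imp x x; rewrite hN1 kneg1. Qed.

Lemma hiffC x y : hiff x y = hiff y x.
Proof. exact: meetC. Qed.

Lemma hiffxx x : hiff x x = \top.
Proof. by rewrite /hiff hN1 meetxx. Qed.

Lemma hsxx x : hs x x = \top.
Proof. by rewrite /hs !hiffxx meetxx. Qed.

Lemma himp1_le y : himp \top y <= y.
Proof. by have := hN2 (\top : T) y; rewrite kneg1 !meet1x join0x. Qed.

Lemma kneg_le x y : x <= y -> kneg y <= kneg x.
Proof. by move/meet_idPl => xy; rewrite -[in leRHS]xy knegI leUr. Qed.

(* When both implications are [1] this reads [x <= y]. *)
Lemma himp_contrapositive_le x y :
  x `&` himp x y <= y `|` kneg (himp (kneg y) (kneg x)).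
Proof.
(* This is (hN2) for [~y] and [~x], turned around by negation. *)
have nyx : x `&` kneg y <= y `|` kneg (himp (kneg y) (kneg x)).
  have := le_trans (hN2 (kneg y) (kneg x)) (leIr _ _).
  by move/kneg_le; rewrite knegI knegU !knegK meetC.
apply: le_trans (hN2 x y) _; rewrite meetUr leUx; apply/andP; split.
  (* The part below [x /\ ~x] is split by the Kleene inequality along [y \/ ~y]; the piece below
     [~y] falls under [nyx]. *)
  rewrite -(kleene x y) meetUr leUx; apply/andP; split.
    by apply: le_trans (leIr _ _) (leUl _ _).
  by apply: le_trans nyx; rewrite leI2 // leIl.
by apply: le_trans (leIr _ _) (leUl _ _).
Qed.

(* [hiff x y] itself serves as the witness [f] with [x /\ f == y /\ f]. *)
Lemma heq_meet_hiff x y : heq (x `&` hiff x y) (y `&` hiff x y).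
Proof.
have half u v : heq (u `&` hiff u v) (u `&` v `&` hiff u v).
  by rewrite /hiff !meetA; exact: heqI2r (heq_meet_imp u v).
apply: heq_trans (half x y) _.
by rewrite (meetC x y) hiffC; exact: heq_sym (half y x).
Qed.

End HemiNelsonEquivalence.

(** * From h-implicative filters to congruences *)

Section FilterToCongruence.
Set Implicit Arguments.
Unset Strict Implicit.
Context {d : Order.disp_t} {T : hemiNelsonType d}.
Variables (F : set T) (hF : h_implicative_filter F).
Implicit Types x y z f : T.

Lemma hif1 : F \top.
Proof. by case: (hif_implicative hF). Qed.

Lemma hif_mp {x} y : F x -> F (himp x y) -> F y.
Proof. by case: (hif_implicative hF) => _; apply. Qed.

(** The premise of (F2) becomes [1], so modus ponens removes it. *)
Lemma hif_imp_relative f x y :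
  F f -> himp (x `&` f) (y `&` f) = \top -> F (himp x y).
Proof. by move=> Ff xy; have := hif_F2 hF x y Ff; rewrite xy; apply: hif_mp hif1. Qed.

Lemma hif_imp1 x : F x -> F (himp \top x).
Proof. by move=> Fx; apply: (hif_imp_relative Fx); rewrite meet1x meetxx hN1. Qed.

(** Relative to [f = x], both [1] and [y] become [x], so [1 -> y] is in [F]. *)
Lemma hif_le x y : x <= y -> F x -> F y.
Proof.
move=> xy Fx; apply: (hif_mp hif1); apply: (hif_imp_relative Fx).
by rewrite meet1x (meet_idPr xy) hN1.
Qed.

Lemma hifI x y : F (x `&` y) <-> F x /\ F y.
Proof.
split=> [Fxy | [Fx Fy]].
  by split; apply: hif_le Fxy; [exact: leIl | exact: leIr].
rewrite meetC; apply: (hif_mp Fx).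
(* Relative to [x], (F1) turns [1 -> y] into [x -> (y /\ x)]. *)
have := hif_F1 hF \top y Fx; rewrite meet1x.
exact: hif_mp (hif_imp1 Fy).
Qed.

Definition heq_mod x y : Prop := exists2 f, F f & heq (x `&` f) (y `&` f).

Lemma heq_modP x y : heq_mod x y <-> F (hiff x y).
Proof.
split=> [[f Ff [xy yx]] | Fxy].
  by apply/hifI; split; apply: (hif_imp_relative Ff).
by exists (hiff x y) => //; exact: heq_meet_hiff.
Qed.

Lemma heq_heq_mod x y : heq x y -> heq_mod x y.
Proof. by move=> xy; exists \top; [exact: hif1 | rewrite !meetx1]. Qed.

Lemma heq_mod_sym x y : heq_mod x y -> heq_mod y x.
Proof. by case=> f Ff /heq_sym; exists f. Qed.

(** [heq] survives meeting both sides with a further element, so the meet of the two witnesses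
    serves both pairs. *)
Lemma heq_mod_common {x x' y y'} : heq_mod x x' -> heq_mod y y' ->
  exists2 f, F f & heq (x `&` f) (x' `&` f) /\ heq (y `&` f) (y' `&` f).
Proof.
move=> [f Ff xx'] [g Fg yy']; exists (f `&` g); first exact/hifI.
split; first by rewrite !meetA; exact: heqI2r.
by rewrite (meetC f) !meetA; exact: heqI2r.
Qed.

Lemma heq_mod_trans y x z : heq_mod x y -> heq_mod y z -> heq_mod x z.
Proof.
move=> xy yz; have [f Ff [xyf yzf]] := heq_mod_common xy yz.
by exists f => //; exact: heq_trans xyf yzf.
Qed.

Lemma heq_modI x x' y y' :
  heq_mod x x' -> heq_mod y y' -> heq_mod (x `&` y) (x' `&` y').
Proof.
move=> xx' yy'; have [f Ff [xf yf]] := heq_mod_common xx' yy'.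
by exists f => //; rewrite -(meetxx f) !(meetACA _ _ f f); exact: heqI.
Qed.

Lemma heq_modU x x' y y' :
  heq_mod x x' -> heq_mod y y' -> heq_mod (x `|` y) (x' `|` y').
Proof.
move=> xx' yy'; have [f Ff [xf yf]] := heq_mod_common xx' yy'.
by exists f => //; rewrite !meetUl; exact: heqU.
Qed.

Lemma heq_mod_imp_relative f x y :
  F f -> heq_mod (himp x y) (himp (x `&` f) (y `&` f)).
Proof.
by move=> Ff; apply/heq_modP/hifI; split; [exact: hif_F1 | exact: hif_F2].
Qed.

(** Meeting with [f] does not commute with implication; (F1) and (F2) allow passing to the
    implication of the meets, where [heq_imp] applies. *)
Lemma heq_mod_imp x x' y y' :
  heq_mod x x' -> heq_mod y y' -> heq_mod (himp x y) (himp x' y').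
Proof.
move=> xx' yy'; have [f Ff [xf yf]] := heq_mod_common xx' yy'.
apply: heq_mod_trans (heq_mod_imp_relative x y Ff) _.
apply: heq_mod_trans (heq_mod_sym (heq_mod_imp_relative x' y' Ff)).
exact/heq_heq_mod/heq_imp.
Qed.

Lemma ThetaP x y :
  Theta F (x, y) <-> heq_mod x y /\ heq_mod (kneg x) (kneg y).
Proof.
rewrite /Theta /= /hs; split=> [/hifI[] /heq_modP xy /heq_modP nxy // |].
by move=> [/heq_modP xy /heq_modP nxy]; exact/hifI.
Qed.

Lemma congruence_Theta : congruence (Theta F).
Proof.
split.
- split.
  + by move=> x; rewrite /Theta /= hsxx; exact: hif1.
  + by move=> x y /ThetaP[xy nxy]; apply/ThetaP; split; exact: heq_mod_sym.
  + move=> x y z /ThetaP[xy nxy] /ThetaP[yz nyz]; apply/ThetaP.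
    by split; [exact: heq_mod_trans xy yz | exact: heq_mod_trans nxy nyz].
- move=> x x' y y' /ThetaP[xx' nxx'] /ThetaP[yy' nyy']; apply/ThetaP.
  by rewrite !knegI; split; [exact: heq_modI | exact: heq_modU].
- move=> x x' y y' /ThetaP[xx' nxx'] /ThetaP[yy' nyy']; apply/ThetaP.
  by rewrite !knegU; split; [exact: heq_modU | exact: heq_modI].
- move=> x x' y y' /ThetaP[xx' _] /ThetaP[yy' nyy']; apply/ThetaP.
  split; first exact: heq_mod_imp.
  (* Trading [~(x -> y)] for [x /\ ~y] reduces the negated half to meets. *)
  apply: heq_mod_trans (heq_heq_mod (heq_neg_imp x y)) _.
  apply: heq_mod_trans (heq_heq_mod (heq_sym (heq_neg_imp x' y'))).
  exact: heq_modI.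
- by move=> x x' /ThetaP[xx' nxx']; apply/ThetaP; rewrite !knegK.
Qed.

Lemma class1_Theta : class1 (Theta F) = F.
Proof.
apply/seteqP; split=> x; last first.
  (* The witness is [x] itself: [x /\ x = 1 /\ x], and [~x /\ x] is equivalent to [0 = ~1 /\ x]. *)
  move=> Fx; apply/ThetaP; split; exists x => //.
    by rewrite meetxx meet1x; exact: heq_refl.
  by rewrite kneg1 meet0x meetC; exact: heq_contradiction.
by move/hifI=> [/hifI[_ F1x] _]; exact: hif_mp hif1 F1x.
Qed.

End FilterToCongruence.

(** * From congruences to h-implicative filters *)

Section CongruenceToFilter.
Set Implicit Arguments.
Unset Strict Implicit.
Context {d : Order.disp_t} {T : hemiNelsonType d}.
Variables (theta : set (T * T)) (ctheta : congruence theta).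
Implicit Types x y z : T.

Lemma cong_refl x : theta (x, x).
Proof. by case: (cong_equiv ctheta) => r _ _; exact: r. Qed.

Lemma cong_sym x y : theta (x, y) -> theta (y, x).
Proof. by case: (cong_equiv ctheta) => _ s _; exact: s. Qed.

Lemma cong_trans y x z : theta (x, y) -> theta (y, z) -> theta (x, z).
Proof. by case: (cong_equiv ctheta) => _ _ t; exact: t. Qed.

Lemma congI2l z x y : theta (x, y) -> theta (z `&` x, z `&` y).
Proof. by move=> xy; exact: (cong_meet ctheta (cong_refl z) xy). Qed.

Lemma congU2l z x y : theta (x, y) -> theta (z `|` x, z `|` y).
Proof. by move=> xy; exact: (cong_join ctheta (cong_refl z) xy). Qed.

Lemma congI1 x y : theta (y, \top) -> theta (x `&` y, x).
Proof. by move=> /(congI2l x); rewrite meetx1. Qed.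

Lemma class1_le x y : x <= y -> class1 theta x -> class1 theta y.
Proof.
move=> xy /(congU2l y).
by rewrite /class1 /= joinx1 (join_idPl xy).
Qed.

Lemma class1_himp x y : theta (x, y) -> class1 theta (himp x y).
Proof.
move=> xy; rewrite /class1 /= -(hN1 y).
exact: (cong_imp ctheta xy (cong_refl y)).
Qed.

Lemma class1_meet x y :
  class1 theta x -> class1 theta y -> class1 theta (x `&` y).
Proof. by move=> x1 y1; exact: cong_trans (congI1 x y1) x1. Qed.

Lemma class1_h_implicative_filter : h_implicative_filter (class1 theta).
Proof.
(* Modulo [theta], [f] is [1], so the two sides related in (F1) to (F4) are congruent. *)
have relative x y f : class1 theta f ->
    theta (himp (x `&` f) (y `&` f), himp x y).
  by move=> f1; exact: (cong_imp ctheta (congI1 x f1) (congI1 y f1)).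
split.
- split=> [|x y x1 xy1]; first exact: cong_refl.
  (* Modus ponens: [y] lies above [1 -> y], which is congruent to [x -> y]. *)
  apply: class1_le (himp1_le y) _; apply: cong_trans xy1.
  exact: (cong_imp ctheta (cong_sym x1) (cong_refl y)).
- by move=> x y f f1; exact/class1_himp/cong_sym/relative.
- by move=> x y f f1; exact/class1_himp/relative.
- by move=> x y f f1; exact/class1_himp/(cong_neg ctheta)/cong_sym/relative.
- by move=> x y f f1; exact/class1_himp/(cong_neg ctheta)/relative.
Qed.

(** Modulo [theta], [himp_contrapositive_le] loses its two implications and becomes [x <= y],
    expressed here as an equation between classes. *)
Lemma cong_meetl x y : class1 theta (himp x y) ->
  class1 theta (himp (kneg y) (kneg x)) -> theta (x, x `&` y).
Proof.
move=> xy1 /(cong_neg ctheta); rewrite kneg1 => nyx0.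
apply: cong_trans (cong_sym (congI1 x xy1)) _.
have := cong_meet ctheta (congI1 x xy1) (congU2l y nyx0).
by rewrite joinx0 (meet_idPl (himp_contrapositive_le x y)).
Qed.

Lemma Theta_class1 : Theta (class1 theta) = theta.
Proof.
apply/seteqP; split=> -[x y] /=; rewrite /Theta /= => xy; last first.
  have nxy := cong_neg ctheta xy.
  by rewrite /hs /hiff; do !apply: class1_meet; apply: class1_himp => //; exact: cong_sym.
have hF := class1_h_implicative_filter.
move: xy => /(hifI hF)[/(hifI hF)[xy1 yx1] /(hifI hF)[nxy1 nyx1]].
(* Antisymmetry in the quotient: [x] and [y] are both congruent to [x /\ y]. *)
apply: cong_trans (cong_meetl xy1 nyx1) _.
by rewrite meetC; exact: cong_sym (cong_meetl yx1 nxy1).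
Qed.

End CongruenceToFilter.

(** * The order isomorphism *)

Local Open Scope classical_set_scope.

Theorem theorem26 (d : Order.disp_t) (T : hemiNelsonType d) :
  (forall theta : set (T * T),
     congruence theta -> h_implicative_filter (class1 theta)) /\
  (forall F : set T,
     h_implicative_filter F -> congruence (Theta F)) /\
  (forall theta : set (T * T),
     congruence theta -> Theta (class1 theta) = theta) /\
  (forall F : set T,
     h_implicative_filter F -> class1 (Theta F) = F) /\
  (forall theta1 theta2 : set (T * T),
     congruence theta1 -> congruence theta2 ->
     (theta1 `<=` theta2 <-> class1 theta1 `<=` class1 theta2)) /\
  (forall F1 F2 : set T,
     h_implicative_filter F1 -> h_implicative_filter F2 ->
     (F1 `<=` F2 <-> Theta F1 `<=` Theta F2)).
Proof.
split; first exact: class1_h_implicative_filter.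
split; first exact: congruence_Theta.
split; first exact: Theta_class1.
split; first exact: class1_Theta.
have Theta_sub (F1 F2 : set T) : F1 `<=` F2 -> Theta F1 `<=` Theta F2.
  by move=> F12 xy; exact: F12.
have class1_sub (t1 t2 : set (T * T)) :
    t1 `<=` t2 -> class1 t1 `<=` class1 t2.
  by move=> t12 x; exact: t12.
split=> [t1 t2 ct1 ct2 | F1 F2 hF1 hF2]; split.
- exact: class1_sub.
(* Order is reflected because the inverse map is monotone. *)
- by move/Theta_sub; rewrite !Theta_class1.
- exact: Theta_sub.
- by move/class1_sub; rewrite !class1_Theta.
Qed.
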